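(* A $k$-translatable semigroup (of order $n$) is left cancellative if and only if it has a left neutral element.
   Context: A groupoid is a set with a binary operation $\cdot$; a semigroup is an associative groupoid. It is left cancellative if $x\cdot y=x\cdot z$ implies $y=z$. An element $e$ is left neutral if $e\cdot x=x$ for all $x$. For an integer $x$, $[x]_n$ denotes the residue of $x$ modulo $n$, represented in $\{1,\ldots,n\}$, with $0$ identified with $n$. All groupoids are finite and taken to be of the form $Q=\{1,\ldots,n\}$ with the natural ordering. For $1\le k<n$, $Q$ is $k$-translatable if in its multiplication table each row $i$, $2\le i\le n$, is obtained from row $i-1$ by cyclically shifting it $k$ places to the right, i.e. $i\cdot j=(i-1)\cdot[j-k]_n$ for all $j$ and all $2\le i\le n$. *)

(* Defs.v *)
From mathcomp Require Import all_boot.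

Set Implicit Arguments.
Unset Strict Implicit.
Unset Printing Implicit Defensive.

(* The carrier {1, ..., n} is represented by 'I_n = {0, ..., n-1} with its
   natural order: the ordinal i stands for the element i + 1.  Under this
   relabelling the residue [x]_n, taken in {1, ..., n}, becomes the usual
   residue modulo n, taken in {0, ..., n-1}. *)

Lemma ord_subm_subproof n (k : nat) (j : 'I_n) : (j + (n - k)) %% n < n.
Proof. by rewrite ltn_pmod // (leq_ltn_trans (leq0n j) (ltn_ord j)). Qed.

(* [j - k]_n, for k <= n; n - k is added because subtraction on nat is
   truncated. *)
Definition ord_subm n (k : nat) (j : 'I_n) : 'I_n :=
  Ordinal (ord_subm_subproof k j).

Definition k_translatable n (k : nat) (op : 'I_n -> 'I_n -> 'I_n) : Prop :=
  forall i' i j : 'I_n, i = i'.+1 :> nat -> op i j = op i' (ord_subm k j).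

Definition left_cancellative (T : Type) (op : T -> T -> T) : Prop :=
  forall x y z : T, op x y = op x z -> y = z.

Definition has_left_neutral (T : Type) (op : T -> T -> T) : Prop :=
  exists e : T, left_id e op.

(* Main.v *)
Require Import Defs.
From mathcomp Require Import all_boot.

Set Implicit Arguments.
Unset Strict Implicit.
Unset Printing Implicit Defensive.

(** Left cancellativity says that every row of the multiplication table is
    injective, hence, the carrier being finite, a permutation.

    If the semigroup is left cancellative, then for any [a] the row of [a]
    attains the value [a], say [a * e = a]; cancelling [a] in
    [a * (e * x) = (a * e) * x = a * x] shows that [e] is left neutral.  This
    is [left_cancellative_left_neutral].

    Conversely, a left neutral element has the identity as its row.  In a
    translatable table consecutive rows differ by a cyclic shift of the columns,
    so as soon as one row is injective all of them are; this is
    [translatable_row_inj]. *)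

Lemma ord_subm_inj n k : injective (@ord_subm n k).
Proof.
move=> i j /(congr1 val) /= /eqP.
by rewrite eqn_modDr !modn_small // => /eqP /val_inj.
Qed.

(** Consecutive rows are precompositions of one another with a cyclic shift,
    which is invertible; hence injectivity passes both down and up the table. *)
Lemma translatable_next_row_inj n k (op : 'I_n -> 'I_n -> 'I_n) (i' i : 'I_n) :
  k_translatable k op -> i = i'.+1 :> nat ->
  injective (op i') <-> injective (op i).
Proof.
move=> tr_op def_i; have row_i j := tr_op i' i j def_i; split=> inj_row x y.
  by rewrite !row_i => /inj_row /ord_subm_inj.
have [unshift _ unshiftK] := injF_bij (@ord_subm_inj n k).
by rewrite -(unshiftK x) -(unshiftK y) -!row_i => /inj_row ->.
Qed.

Lemma translatable_row_inj n k (op : 'I_n -> 'I_n -> 'I_n) (e i : 'I_n) :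
  k_translatable k op -> injective (op e) -> injective (op i).
Proof.
move=> tr_op.
suff rows_inj d (a b : 'I_n) : b = d + a :> nat ->
    injective (op a) <-> injective (op b).
  case: (leqP e i) => [le_ei | /ltnW le_ie].
    by apply: (rows_inj (i - e) e i _).1; rewrite subnK.
  by apply: (rows_inj (e - i) i e _).2; rewrite subnK.
elim: d b => [|d IHd] b def_b; first by rewrite (val_inj def_b).
have lt_dn : d + a < n by rewrite -addSn -def_b ltnW.
apply: iff_trans (IHd (Ordinal lt_dn) erefl) _.
by apply: translatable_next_row_inj tr_op _; rewrite def_b.
Qed.

(** Finiteness makes the injective row of [a] surjective, which provides a right
    unit [e] of the single element [a]; associativity and cancellation turn it
    into a left unit of every element. *)
Lemma left_cancellative_left_neutral (T : finType) (op : T -> T -> T) (a : T) :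
  associative op -> left_cancellative op -> has_left_neutral op.
Proof.
move=> opA op_lcancel.
have [row_inv _ row_invK] := injF_bij (op_lcancel a).
by exists (row_inv a) => x; apply: (op_lcancel a); rewrite opA row_invK.
Qed.

Theorem corollary5p2 (n k : nat) (op : 'I_n -> 'I_n -> 'I_n)
    (hk : 1 <= k < n) (hassoc : associative op)
    (htrans : k_translatable k op) :
  left_cancellative op <-> has_left_neutral op.
Proof.
have /andP[_ lt_kn] := hk; split=> [|[e op_e] x].
  exact: (left_cancellative_left_neutral (Ordinal lt_kn)).
apply: (translatable_row_inj (e := e) htrans) => y z.
by rewrite !op_e.
Qed.
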